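(* Let $p\geqslant 1$, let $\alpha,\beta\in\mathbb{R}$ with $\alpha\leqslant 0$, and consider two agents with the linear utility (scoring) function $g(k)=\alpha k+\beta$, where the preference orders of the agents are independent and uniformly distributed over all $p!$ orders of the $p$ items. Then the alternating policy $\pi^*_p=1212\ldots$ of length $p$ maximizes the expected utilitarian social welfare: for every policy $\pi\in\{1,2\}^p$, $\overline{\mathrm{sw}}(\pi)\leqslant\overline{\mathrm{sw}}(\pi^*_p)$.
   Context: There are $p$ indivisible items and $n$ agents (here $n=2$). Each agent has a strict total preference order over the items; a profile $R$ is an $n$-tuple of such orders. All agents share the same utility function $g$: an item in $k$-th position of an agent's order ($k=1$ is most preferred) has utility $g(k)$ for that agent. The utility of a set of items is the sum of the individual utilities. A policy is a sequence $\pi=\pi_1\ldots\pi_p\in\{1,\ldots,n\}^p$; at step $k$ agent $\pi_k$ picks one of the remaining items, namely the one she ranks highest among the remaining items. $u_R(i,\pi)$ is the total utility obtained by agent $i$ for profile $R$, $\overline{u_i}(\pi)$ is the expectation of $u_R(i,\pi)$ over random profiles, and $\overline{\mathrm{sw}}(\pi)=\sum_{i=1}^n\overline{u_i}(\pi)$ is the expected utilitarian social welfare. *)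

(* Defs.v *)
From HB Require Import structures.
From mathcomp Require Import all_boot all_order all_fingroup all_algebra.

Set Implicit Arguments.
Unset Strict Implicit.
Unset Printing Implicit Defensive.

Import GRing.Theory Num.Theory.
Local Open Scope ring_scope.

(* Agents are 'I_n and items are 'I_p.  A strict total order on the items is  *)
(* encoded by the permutation that maps each item to its position, counted    *)
(* from 0: the most preferred item is mapped to 0.                            *)
Definition profile (n p : nat) := {ffun 'I_n -> 'S_p}.

Definition position (n p : nat) (R : profile n p) (i : 'I_n) (x : 'I_p) : nat :=
  (R i x : 'I_p).+1.

Definition policy (n p : nat) := p.-tuple 'I_n.

(* None is returned only when S is empty. *)
Definition best (n p : nat) (R : profile n p) (i : 'I_n) (S : {set 'I_p}) :
    option 'I_p :=
  [pick x in S | [forall y in S, (position R i x <= position R i y)%N]].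

(* Items obtained by agent i when the agents listed in s pick in turn, the    *)
(* set S being what remains at the start.                                     *)
Fixpoint bundle_from (n p : nat) (R : profile n p) (i : 'I_n)
    (S : {set 'I_p}) (s : seq 'I_n) : {set 'I_p} :=
  if s is a :: s' then
    if best R a S is Some x then
      let rest := bundle_from R i (S :\ x) s' in
      if a == i then x |: rest else rest
    else set0
  else set0.

Definition bundle (n p : nat) (R : profile n p) (i : 'I_n)
    (pi : policy n p) : {set 'I_p} := bundle_from R i [set: 'I_p] pi.

(* The scoring function g is indexed by the 1-based position. *)
Definition utility (F : realFieldType) (n p : nat) (g : nat -> F)
    (R : profile n p) (i : 'I_n) (pi : policy n p) : F :=
  \sum_(x in bundle R i pi) g (position R i x).

(* Uniform law on the p! orders, and the product law it induces on profiles   *)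
(* when the orders of the agents are independent.                             *)
Definition order_prob (F : realFieldType) (p : nat) (r : 'S_p) : F :=
  (p`!%:R)^-1.

Definition profile_prob (F : realFieldType) (n p : nat) (R : profile n p) : F :=
  \prod_(i < n) order_prob F (R i).

Definition expected_utility (F : realFieldType) (n p : nat) (g : nat -> F)
    (i : 'I_n) (pi : policy n p) : F :=
  \sum_(R : profile n p) profile_prob F R * utility g R i pi.

Definition expected_sw (F : realFieldType) (n p : nat) (g : nat -> F)
    (pi : policy n p) : F :=
  \sum_(i < n) expected_utility g i pi.

(* The policy 1212... of length p; agents 1 and 2 are 0 and 1 in 'I_2. *)
Definition alternating (p : nat) : policy 2 p :=
  [tuple inord (k %% 2) | k < p].

Definition linear_score (F : realFieldType) (alpha beta : F) (k : nat) : F :=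
  alpha * k%:R + beta.

(* Main.v *)
Require Import Defs.
From mathcomp Require Import all_boot all_order all_fingroup all_algebra.
From mathcomp Require Import ring lra zify.

Set Implicit Arguments.
Unset Strict Implicit.
Unset Printing Implicit Defensive.

Import Order.TTheory GRing.Theory Num.Theory.
Local Open Scope ring_scope.

(** By linearity, welfare is a constant minus alpha times the total Borda score
    [p - r] of the picked items, [r] being the 0-based position. If agent [a]
    picks first, deleting the item she gets leaves a uniform random profile on
    the remaining items; this shifts nothing in the Borda scores of [a], and
    multiplies the expected Borda scores of the others by [(p + 1) / p]. Hence
    agent [i] expects [(p + 1) * share i pi] with [share] as defined below.

    To maximize a weighted sum [P * share false s + Q * share true s], the agent
    with the larger weight should pick first: by induction an optimal policy
    that starts with the other one may be assumed to let her pick second, and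
    exchanging these two picks gives weights for the rest that weakly majorize
    the former ones. From equal weights this rule yields alternation. *)

(** * Normalized shares, and optimal picking for two weighted agents *)

Section Share.
Variable F : realFieldType.

Definition pick_weight (m : nat) : F := m%:R / m.+1%:R.

(** Dividing expected Borda scores by the number of items plus one absorbs the factor [(p + 1) / p]
    due to a pick by another agent, so such a pick leaves the share unchanged. *)
Fixpoint share (T : eqType) (i : T) (s : seq T) : F :=
  if s is a :: s' then
    if a == i then pick_weight (size s) * (1 + share i s') else share i s'
  else 0.

Lemma pick_weight_ge0 m : 0 <= pick_weight m.
Proof. by rewrite divr_ge0 ?ler0n. Qed.

Lemma pick_weight_le m n : (m <= n)%N -> pick_weight m <= pick_weight n.
Proof.
move=> le_mn; rewrite ler_pdivrMr ?ltr0n // mulrAC ler_pdivlMr ?ltr0n //.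
by rewrite -!natrM ler_nat; nia.
Qed.

Lemma pick_weight_le1 m : pick_weight m <= 1.
Proof. by rewrite ler_pdivrMr ?ltr0n // mul1r ler_nat. Qed.

Lemma share_ge0 (T : eqType) (i : T) s : 0 <= share i s.
Proof.
elim: s => //= a s IHs; case: ifP => // _.
by rewrite mulr_ge0 ?pick_weight_ge0 ?addr_ge0.
Qed.

Lemma share_map (T U : eqType) (f : T -> U) (i : T) s :
  injective f -> share (f i) (map f s) = share i s.
Proof.
by move=> f_inj; elim: s => //= a s IHs; rewrite inj_eq // IHs size_map.
Qed.

(** With booleans as agents, exchanging their roles is [map negb]. *)
Definition weighted_share (P Q : F) (s : seq bool) : F :=
  P * share false s + Q * share true s.

Lemma weighted_share_swap P Q s :
  weighted_share P Q (map negb s) = weighted_share Q P s.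
Proof.
rewrite /weighted_share -{1}[false]/(~~ true) -{2}[true]/(~~ false).
by rewrite !share_map 1?addrC; try exact: (can_inj negbK).
Qed.

Lemma weighted_share_false P Q s (w := pick_weight (size s).+1) :
  weighted_share P Q (false :: s) = P * w + weighted_share (P * w) Q s.
Proof. by rewrite /weighted_share /= -/w; ring. Qed.

Lemma weighted_share_true P Q s (w := pick_weight (size s).+1) :
  weighted_share P Q (true :: s) = Q * w + weighted_share P (Q * w) s.
Proof. by rewrite /weighted_share /= -/w; ring. Qed.

(* The hypotheses say that (a, b) weakly majorizes (c, d). *)
Lemma weighted_share_major (a b c d : F) s :
    c <= a -> d <= a -> c + d <= a + b ->
  exists2 t, size t = size s & weighted_share c d s <= weighted_share a b t.
Proof.
move=> ca da cdab.
have X0 := share_ge0 false s; have Y0 := share_ge0 true s.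
(* The larger weight [a] should meet the larger share; if that is the share of [true], the agents
   are exchanged. *)
have [XY|/ltW XY] := lerP (share true s) (share false s).
  exists s => //; rewrite /weighted_share; nra.
exists (map negb s); rewrite ?size_map // weighted_share_swap.
by rewrite /weighted_share; nra.
Qed.

Lemma first_pick_largest (P Q : F) s : 0 <= Q -> Q <= P -> (0 < size s)%N ->
  exists2 t, size t = (size s).-1
    & weighted_share P Q s <= weighted_share P Q (false :: t).
Proof.
elim: s P Q => // -[] s IHs P Q Q0 QP _; last by exists s.
have [s_nil|s_gt0] := posnP (size s).
  exists s => //; rewrite weighted_share_true weighted_share_false.
  rewrite (size0nil s_nil) /weighted_share /= !mulr0 !addr0.
  by rewrite ler_wpM2r ?pick_weight_ge0.
set w := pick_weight (size s).+1; set w' := pick_weight (size s).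
have w0 : 0 <= w := pick_weight_ge0 _.
have w'0 : 0 <= w' := pick_weight_ge0 _.
have w1 : w <= 1 := pick_weight_le1 _.
have w'w : w' <= w by apply: pick_weight_le.
(* After her pick, [true] has weight [Q * w], still at most [P], so by induction [false] may pick
   second. *)
have QwP : Q * w <= P by nra.
have [t t_size st] := IHs P (Q * w) (mulr_ge0 Q0 w0) QwP s_gt0.
have t1_size : (size t).+1 = size s by rewrite t_size prednK.
(* Left: weights after [true], [false]; right: after [false], [true]. The sums compare because
   [(P - Q) * (w - w')] is nonnegative; the same inequality compares the immediate gains at the
   end. *)
have [t' t'_size tt'] : exists2 t', size t' = size t
   & weighted_share (P * w') (Q * w) t <= weighted_share (P * w) (Q * w') t'.
  by apply: weighted_share_major; nra.
exists (true :: t'); first by rewrite /= t'_size t1_size.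
rewrite weighted_share_true (le_trans (lerD (lexx _) st)) //.
rewrite !weighted_share_false weighted_share_true /= t'_size t1_size -/w -/w'.
nra.
Qed.

(* The hypothesis [P * w <= Q] makes the other agent the next one to pick, and
   it is inherited by the weights [(Q, P * w)] of the remaining policy. *)
Lemma alternating_optimal (P Q : F) s :
    0 <= Q -> Q <= P -> P * pick_weight (size s) <= Q ->
  weighted_share P Q s <= weighted_share P Q (mkseq odd (size s)).
Proof.
have [m] := ubnP (size s); elim: m s P Q => // m IHm [|a s] P Q //= s_lt Q0 QP.
set w := pick_weight _ => PwQ.
have [t /= t_size st] := first_pick_largest Q0 QP (isT : 0 < size (a :: s))%N.
apply: le_trans st _; rewrite -t_size.
have -> : mkseq odd (size t).+1 = false :: map negb (mkseq odd (size t)).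
  by rewrite /mkseq /= (iotaDl 1 0) -!map_comp.
rewrite !weighted_share_false size_map size_mkseq t_size -/w lerD2l.
(* Exchanging the agents turns the weights [(P * w, Q)] into [(Q, P * w)], the larger one first. *)
rewrite weighted_share_swap -(mapK negbK t) weighted_share_swap -t_size.
rewrite -(size_map negb t).
have w0 : 0 <= w := pick_weight_ge0 _.
have P0 : 0 <= P := le_trans Q0 QP.
apply: IHm; rewrite ?size_map ?t_size //; first by rewrite mulr_ge0.
have : pick_weight (size s) <= w by apply: pick_weight_le.
have := pick_weight_ge0 (size s).
nra.
Qed.

End Share.

(** * Greedy picks and bundle sizes *)

Section Bundles.
Variables (n p : nat).
Implicit Types (R : profile n p) (i a : 'I_n) (x y : 'I_p) (S : {set 'I_p}).

Lemma bestP R a S y :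
  reflect (y \in S /\ forall z, z \in S -> (R a y <= R a z)%N)
          (best R a S == Some y).
Proof.
rewrite /best /position; apply: (iffP eqP).
  by case: pickP => // x /andP[xS /forall_inP x_min] [<-]; split.
case=> yS y_min; case: pickP => [z /andP[zS /forall_inP z_min] | /(_ y)].
  congr Some; apply: (@perm_inj _ (R a)); apply/val_inj/anti_leq.
  by rewrite y_min // -ltnS z_min.
rewrite yS /= => /negbT/forall_inPn[z zS]; rewrite ltnS.
by rewrite y_min.
Qed.

Lemma best_exists R a S : S != set0 -> exists2 y, y \in S & best R a S = Some y.
Proof.
move=> /set0Pn[x0 x0S].
have [y' y'S y'_min] := arg_minnP (fun y => R a y : nat) x0S.
by exists y' => //; apply/eqP/bestP.
Qed.

Lemma bundle_from_sub R i S s : bundle_from R i S s \subset S.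
Proof.
elim: s S => [|a s IHs] S /=; first exact: sub0set.
case bE: (best R a S) => [x|]; last exact: sub0set.
have /bestP[xS _] : best R a S == Some x by rewrite bE.
have sub_rest := subset_trans (IHs (S :\ x)) (subD1set S x).
by case: ifP; rewrite // subUset sub1set xS.
Qed.

(** Every pick succeeds while items suffice, and no item is taken twice. This makes the constant
    part of the welfare independent of the policy. *)
Lemma card_bundle_from R i S s :
  (size s <= #|S|)%N -> #|bundle_from R i S s| = count_mem i s.
Proof.
elim: s S => [|a s IHs] S /= sS; first exact: cards0.
have S0 : S != set0 by rewrite -card_gt0 (leq_trans _ sS).
have [x xS ->] := best_exists R a S0.
have sSx : (size s <= #|S :\ x|)%N by move: sS; rewrite (cardsD1 x S) xS.
case: eqP => _; last exact: IHs.
rewrite cardsU1 IHs // (contra (subsetP (bundle_from_sub _ _ _ _) x)) //.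
by rewrite setD11.
Qed.

End Bundles.

Lemma sum_count_mem (T : finType) (s : seq T) :
  (\sum_(i : T) count_mem i s = size s)%N.
Proof.
elim: s => [|a s IHs] /=; first by rewrite big1.
rewrite big_split /= IHs (bigD1 a) //= eqxx big1 // => i /negPf.
by rewrite eq_sym => ->.
Qed.

(** * Deleting and reinserting an item in a profile *)

Definition lift_profile (n p : nat) (x : 'I_p.+1) (k : {ffun 'I_n -> 'I_p.+1})
    (R : profile n p) : profile n p.+1 :=
  [ffun i => lift_perm x (k i) (R i)].

Section LiftProfile.
Variables (n p : nat).
Implicit Types (R : profile n p) (i a : 'I_n) (x : 'I_p.+1).
Implicit Types (k : {ffun 'I_n -> 'I_p.+1}) (S : {set 'I_p}).

Lemma lift_profile_id x k R i : lift_profile x k R i x = k i.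
Proof. by rewrite ffunE lift_perm_id. Qed.

Lemma lift_profile_lift x k R i y :
  lift_profile x k R i (lift x y) = lift (k i) (R i y).
Proof. by rewrite ffunE lift_perm_lift. Qed.

(** The value at [x] recovers [k], and the rest recovers [R]; surjectivity follows by counting. So
    under the uniform law the positions of [x] are independent of the profile on the other items. *)
Lemma lift_profile_bij x :
  bijective (fun kR : {ffun 'I_n -> 'I_p.+1} * profile n p =>
               lift_profile x kR.1 kR.2).
Proof.
apply: inj_card_bij => [[k R] [k' R'] /= eqR|].
  have eqk : k = k'.
    by apply/ffunP => i; rewrite -(lift_profile_id x k R) eqR lift_profile_id.
  rewrite -eqk in eqR *; congr pair; apply/ffunP => i; apply/permP => y.
  by apply: (@lift_inj _ (k i)); rewrite -!(lift_profile_lift x) eqR.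
by rewrite card_prod !card_ffun !card_Sn !card_ord factS expnMn.
Qed.

(** Inserting [x] preserves the relative order of the other items. *)
Lemma best_lift_profile x k R a S :
  best (lift_profile x k R) a (lift x @: S) = omap (lift x) (best R a S).
Proof.
have [->|/(best_exists R a)[y yS yE]] := eqVneq S set0.
  rewrite imset0 /best; case: pickP => [z|_]; first by rewrite inE.
  by case: pickP => // z; rewrite inE.
rewrite yE; apply/eqP/bestP; split=> [|_ /imsetP[z zS ->]].
  exact: imset_f.
rewrite !lift_profile_lift leq_bump2.
by have /bestP[_ ->] : best R a S == Some y by rewrite yE.
Qed.

Lemma bundle_from_lift_profile x k R i S s :
  bundle_from (lift_profile x k R) i (lift x @: S) s
  = lift x @: bundle_from R i S s.
Proof.
elim: s S => [|a s IHs] S /=; first by rewrite imset0.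
rewrite best_lift_profile.
case: (best R a S) => [y|] /=; last by rewrite imset0.
have -> : lift x @: S :\ lift x y = lift x @: (S :\ y).
  apply/setP => z; rewrite !inE; apply/andP/imsetP.
    case=> zy /imsetP[u uS zE]; exists u => //.
    by rewrite !inE uS -(inj_eq (@lift_inj _ x)) -zE zy.
  by case=> u /setD1P[uy uS] ->; rewrite (inj_eq (@lift_inj _ x)) uy imset_f.
by rewrite IHs; case: ifP => // _; rewrite imsetU1.
Qed.

Lemma bundle_lift_profile x k R a i s : k a = ord0 ->
  bundle_from (lift_profile x k R) i setT (a :: s)
  = let rest := lift x @: bundle_from R i setT s in
    if a == i then x |: rest else rest.
Proof.
move=> ka /=; have /eqP -> : best (lift_profile x k R) a setT == Some x.
  by apply/bestP; split=> [|z _]; rewrite ?in_setT // lift_profile_id ka.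
have -> : setT :\ x = lift x @: setT.
  apply/setP => z; rewrite !inE andbT; apply/idP/imsetP => [zx|[y _ ->]].
    by have [y ->|zE] := unliftP x z; [exists y | rewrite zE eqxx in zx].
  by rewrite eq_sym neq_lift.
by rewrite bundle_from_lift_profile.
Qed.

End LiftProfile.

(** * Borda scores summed over all profiles *)

Section BordaTotal.
Variable F : realFieldType.

Definition borda (n p : nat) (R : profile n p) (i : 'I_n) (s : seq 'I_n) : F :=
  \sum_(x in bundle_from R i setT s) (p%:R - (R i x)%:R).

Definition borda_total (n p : nat) (i : 'I_n) (s : seq 'I_n) : F :=
  \sum_(R : profile n p) borda R i s.

(** Each profile has exactly one item [x] on top for [a], the one she takes if she picks first. *)
Lemma sum_profile_first (n p : nat) (a : 'I_n) (f : profile n p.+1 -> F) :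
  \sum_R f R
  = \sum_x \sum_(k : {ffun 'I_n -> 'I_p.+1} | k a == ord0)
      \sum_(R : profile n p) f (lift_profile x k R).
Proof.
transitivity (\sum_x \sum_(R : profile n p.+1 | R a x == ord0) f R).
  rewrite (exchange_big_dep xpredT) //=; apply: eq_bigr => R _.
  rewrite (big_pred1 ((R a)^-1%g ord0)) // => x /=.
  by rewrite -(inj_eq (@perm_inj _ (R a)) x) permKV.
apply: eq_bigr => x _.
rewrite (reindex (fun kR => lift_profile x kR.1 kR.2)) /=; last first.
  exact: onW_bij (lift_profile_bij n x).
rewrite pair_big /=; apply: eq_bigl => -[k R] /=.
by rewrite lift_profile_id andbT.
Qed.

(* Stated with factors on both sides to avoid the truncated exponent n - 2. *)
Lemma sum_ffun_fixed (n m : nat) (a i : 'I_n) (G : 'I_m.+1 -> F) : a != i ->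
  m.+1%:R ^+ 2 * (\sum_(k : {ffun 'I_n -> 'I_m.+1} | k a == ord0) G (k i))
  = m.+1%:R ^+ n * \sum_j G j.
Proof.
rewrite eq_sym => ia.
(* With the constraint at [a] as an indicator, the summand is a product over agents, so the sum over
   [k] factors. *)
pose H l (j : 'I_m.+1) : F :=
  if l == a then (j == ord0)%:R else if l == i then G j else 1.
have -> : \sum_(k : {ffun 'I_n -> 'I_m.+1} | k a == ord0) G (k i)
          = \prod_l \sum_j H l j.
  rewrite bigA_distr_bigA big_mkcond; apply: eq_bigr => k _.
  rewrite (bigD1 a) //= (bigD1 i) //= /H !eqxx (negPf ia).
  rewrite big1 ?mulr1 => [|l /andP[/negPf-> /negPf->]] //.
  by case: eqP => _; rewrite ?mul1r ?mul0r.
have -> : m.+1%:R ^+ n = \prod_(l < n) m.+1%:R :> F.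
  by rewrite prodr_const card_ord.
have prodD2 (f : 'I_n -> F) :
    \prod_l f l = f a * (f i * \prod_(l | (l != a) && (l != i)) f l).
  by rewrite (bigD1 a) //= (bigD1 i).
rewrite !prodD2.
have -> : \sum_j H a j = 1.
  rewrite (bigD1 ord0) //= /H eqxx big1 ?addr0 //.
  by move=> j /negPf ->.
have -> : \sum_j H i j = \sum_j G j.
  by apply: eq_bigr => j _; rewrite /H eqxx (negPf ia).
set c := \prod_(l < n | _) m.+1%:R.
have -> : \prod_(l < n | (l != a) && (l != i)) \sum_j H l j = c.
  apply: eq_bigr => l /andP[/negPf la /negPf li].
  by rewrite /H la li sumr_const card_ord.
by ring.
Qed.

Lemma card_ffun_fixed (n m : nat) (a : 'I_n) :
  m.+1%:R * (\sum_(k : {ffun 'I_n -> 'I_m.+1} | k a == ord0) 1)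
  = m.+1%:R ^+ n :> F.
Proof.
pose H l (j : 'I_m.+1) : F := if l == a then (j == ord0)%:R else 1.
have -> : \sum_(k : {ffun 'I_n -> 'I_m.+1} | k a == ord0) 1
          = \prod_l \sum_j H l j.
  rewrite bigA_distr_bigA big_mkcond; apply: eq_bigr => k _.
  rewrite (bigD1 a) //= /H eqxx big1 ?mulr1 => [|l /negPf->] //.
  by case: eqP.
have -> : m.+1%:R ^+ n = \prod_(l < n) m.+1%:R :> F.
  by rewrite prodr_const card_ord.
rewrite (bigD1 a) //= [in RHS](bigD1 a) //=.
have -> : \sum_j H a j = 1.
  rewrite (bigD1 ord0) //= /H eqxx big1 ?addr0 //.
  by move=> j /negPf ->.
rewrite mul1r; congr (_ * _); apply: eq_bigr => l /negPf la.
by rewrite /H la sumr_const card_ord.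
Qed.

(** Exactly the [j + 1] insertion positions [k <= j] push [j] down by one. This is the source of the
    factor [(p + 1) / p]. *)
Lemma sum_lift (m : nat) (j : 'I_m) :
  \sum_(k < m.+1) (m.+1%:R - (lift k j)%:R) = m.+2%:R * (m%:R - j%:R) :> F.
Proof.
have jm := ltnW (ltn_ord j).
have -> : \sum_(k < m.+1) (m.+1%:R - (lift k j)%:R)
   = \sum_(k < m.+1) (m.+1%:R - j%:R - (k <= j)%:R) :> F.
  by apply: eq_bigr => k _; rewrite /= /bump natrD; ring.
rewrite sumrB sumr_const card_ord -natr_sum.
have -> : (\sum_(k < m.+1) (k <= j) = j.+1)%N.
  rewrite -(big_mkord xpredT (fun k => (k <= j)%N : nat)) /=.
  rewrite (big_cat_nat _ (n := j.+1)) //= big_nat (eq_bigr (fun=> 1%N)).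
    rewrite -big_nat sum_nat_const_nat muln1 subn0 big_nat big1 ?addn0 //.
    by move=> k /andP[]; rewrite ltnNge => /negPf->.
  by move=> k /andP[_]; rewrite ltnS => ->.
by rewrite -mulr_natl -!natr1; ring.
Qed.

(** Her other items move down one place, which the extra item in the count offsets. *)
Lemma borda_lift_first (n p : nat) x (k : {ffun 'I_n -> 'I_p.+1})
    (R : profile n p) a s : k a = ord0 ->
  borda (lift_profile x k R) a (a :: s) = p.+1%:R + borda R a s.
Proof.
move=> ka; rewrite /borda bundle_lift_profile // eqxx /=.
rewrite big_setU1 /=; last first.
  by apply/imsetP => -[y _ /eqP]; rewrite (negPf (neq_lift _ _)).
rewrite lift_profile_id ka subr0 big_imset /=; last first.
  by move=> y z _ _; exact: lift_inj.
congr (_ + _); apply: eq_bigr => y _.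
by rewrite lift_profile_lift ka /= /bump add1n -!natr1; ring.
Qed.

Lemma borda_lift_other (n p : nat) x (k : {ffun 'I_n -> 'I_p.+1})
    (R : profile n p) a i s : k a = ord0 -> a != i ->
  borda (lift_profile x k R) i (a :: s)
  = \sum_(y in bundle_from R i setT s) (p.+1%:R - (lift (k i) (R i y))%:R).
Proof.
move=> ka /negPf ai; rewrite /borda bundle_lift_profile // ai.
rewrite big_imset /=; last by move=> y z _ _; exact: lift_inj.
by apply: eq_bigr => y _; rewrite lift_profile_lift.
Qed.

Lemma borda_total_share (n p : nat) (i : 'I_n) (s : seq 'I_n) : size s = p ->
  borda_total p i s = p`!%:R ^+ n * p.+1%:R * share F i s.
Proof.
move=> <-; elim: s => [|a s IHs] /=.
  by rewrite mulr0 /borda_total big1 // => R _; rewrite /borda big_set0.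
set m := size s in IHs *.
have m1 : m.+1%:R != 0 :> F by rewrite pnatr_eq0.
have m2 : m.+2%:R != 0 :> F by rewrite pnatr_eq0.
rewrite {1}/borda_total (sum_profile_first a) /= factS natrM exprMn.
have card_profile : \sum_(R : profile n m) 1 = m`!%:R ^+ n :> F.
  by rewrite sumr_const card_ffun card_Sn card_ord -natrX.
case: eqVneq => [ai|ai].
  rewrite -{i}ai in IHs *.
  transitivity (\sum_(x < m.+1)
    (\sum_(k : {ffun 'I_n -> 'I_m.+1} | k a == ord0) 1)
    * (m.+1%:R * m`!%:R ^+ n + borda_total m a s)).
    apply: eq_bigr => x _; rewrite mulr_suml; apply: eq_bigr => k /eqP ka.
    rewrite mul1r -card_profile mulr_sumr -big_split /=.
    by apply: eq_bigr => R _; rewrite borda_lift_first // mulr1.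
  rewrite sumr_const card_ord -[LHS]mulr_natl mulrA card_ffun_fixed IHs.
  by rewrite /pick_weight -!natr1 in m1 m2 *; field.
have m1X : m.+1%:R ^+ 2 != 0 :> F by rewrite expf_eq0.
apply: (mulfI m1X); rewrite mulr_sumr.
transitivity (\sum_(x < m.+1) m.+1%:R ^+ n * (m.+2%:R * borda_total m i s)).
  (* The items obtained later depend on [R] alone, so for fixed [R] each score can be summed over
     the insertion position. *)
  apply: eq_bigr => x _; rewrite exchange_big /= mulr_sumr [RHS]mulrA.
  rewrite /borda_total [RHS]mulr_sumr; apply: eq_bigr => R _.
  transitivity (m.+1%:R ^+ 2 * (\sum_(y in bundle_from R i setT s)
     \sum_(k : {ffun 'I_n -> 'I_m.+1} | k a == ord0)
       (m.+1%:R - (lift (k i) (R i y))%:R) : F)).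
    congr (_ * _); rewrite exchange_big /=; apply: eq_bigr => k /eqP ka.
    exact: borda_lift_other.
  rewrite !mulr_sumr; apply: eq_bigr => y _.
  rewrite -mulrA (sum_ffun_fixed (fun j => m.+1%:R - (lift j (R i y))%:R) ai).
  by rewrite sum_lift mulrA.
rewrite sumr_const card_ord -[LHS]mulr_natl IHs; ring.
Qed.

End BordaTotal.

(** * From linear scores to shares, and the conclusion *)

Lemma expected_utility_linear (F : realFieldType) (n p : nat)
    (alpha beta : F) (i : 'I_n) (pi : policy n p) :
  expected_utility (linear_score alpha beta) i pi
  = (alpha * p.+1%:R + beta) * (count_mem i pi)%:R
    - alpha * p.+1%:R * share F i pi.
Proof.
have prob_profile (R : profile n p) : profile_prob F R = (p`!%:R ^+ n)^-1.
  by rewrite /profile_prob /order_prob prodr_const card_ord exprVn.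
have fact_neq0 : p`!%:R ^+ n != 0 :> F.
  by rewrite expf_neq0 // pnatr_eq0 -lt0n fact_gt0.
have card_profile : \sum_(R : profile n p) 1 = p`!%:R ^+ n :> F.
  by rewrite sumr_const card_ffun card_Sn card_ord -natrX.
(* For a 0-based position [r], [alpha * (r + 1) + beta] equals [alpha * (p + 1) + beta] minus
   [alpha * (p - r)]. *)
have utilityE (R : profile n p) : utility (linear_score alpha beta) R i pi
    = (alpha * p.+1%:R + beta) * (count_mem i pi)%:R * 1
      - alpha * borda F R i pi.
  rewrite mulr1 -(@card_bundle_from _ _ R i setT);
    last by rewrite cardsT card_ord size_tuple.
  rewrite mulr_natr -sumr_const /borda mulr_sumr -sumrB; apply: eq_bigr => x _.
  by rewrite /linear_score /position -!natr1; ring.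
rewrite /expected_utility.
under eq_bigr => R _ do rewrite prob_profile utilityE.
rewrite -mulr_sumr sumrB -!mulr_sumr card_profile -/(borda_total F p i pi).
by rewrite borda_total_share ?size_tuple //; field.
Qed.

Lemma expected_sw_linear (F : realFieldType) (n p : nat) (alpha beta : F)
    (pi : policy n p) :
  expected_sw (linear_score alpha beta) pi
  = (alpha * p.+1%:R + beta) * p%:R
    - alpha * p.+1%:R * \sum_i share F i pi.
Proof.
rewrite /expected_sw; under eq_bigr do rewrite expected_utility_linear.
by rewrite sumrB -!mulr_sumr -natr_sum sum_count_mem size_tuple.
Qed.

Lemma sum_share2 (F : realFieldType) (s : seq 'I_2) :
  \sum_i share F i s = weighted_share 1 1 (map (odd \o val) s).
Proof.
have odd_inj : injective (fun i : 'I_2 => odd i).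
  by case=> [[|[|//]] ?] [[|[|//]] ?] //= _; apply: val_inj.
rewrite big_ord_recl big_ord1 /weighted_share !mul1r.
by congr (_ + _); rewrite -(share_map _ _ _ odd_inj).
Qed.

Lemma alternating_odd (p : nat) :
  map (odd \o val) (alternating p) = mkseq odd p.
Proof.
rewrite /mkseq -val_enum_ord -!map_comp; apply: eq_map => k /=.
by rewrite inordK ?ltn_pmod // modn2 oddb.
Qed.

Theorem mainTheorem2 (F : realFieldType) (p : nat) (hp : (1 <= p)%N)
    (alpha beta : F) (halpha : alpha <= 0) (pi : policy 2 p) :
  expected_sw (linear_score alpha beta) pi
    <= expected_sw (linear_score alpha beta) (alternating p).
Proof.
rewrite !expected_sw_linear lerD2l lerN2.
apply: ler_wnM2l; first by rewrite mulr_le0_ge0 ?ler0n.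
rewrite !sum_share2 alternating_odd.
rewrite -[X in mkseq odd X](size_tuple pi) -(size_map (odd \o val) pi).
(* With both weights 1, the inherited hypothesis is just that a pick weight is at most 1. *)
by apply: alternating_optimal; rewrite ?ler01 // mul1r pick_weight_le1.
Qed.
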